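(* Let $p(x,y)=\sum_{i=0}^{d}\binom{d}{i}c_i\,x^{i}y^{d-i}$ be a nonzero real binary form of degree $d>1$, and let $[\epsilon,\mathbf{s},\mathbf{R},\boldsymbol{\lambda}]$ be the output of the algorithm RWD (described in the context) applied to $p$, with $\mathbf{R}=(R_1,R_2)$. (i) If $\epsilon=1$, so that $d=2\nu+1$, $\mathbf{s}=(s_1,\dots,s_\nu,s_{\nu+1})$ and $\boldsymbol{\lambda}=[\lambda_1,\dots,\lambda_d]$, then $$p(x,y)=\sum_{j=1}^{\nu}\lambda_{2j-1}(x+s_jy)^d+\sum_{j=1}^{\nu}\lambda_{2j}(x-s_jy)^d+\lambda_d(R_1x+R_2y)^d .$$ (ii) If $\epsilon=0$, so that $d=2\nu$, $\mathbf{s}=(s,s_1,\dots,s_{\nu-1},s_{\nu+1})$ and $\boldsymbol{\lambda}=[\lambda_{d-1},\lambda_1,\dots,\lambda_{d-2},\lambda_d]$, then $$p(x,y)=\sum_{j=1}^{\nu-1}\lambda_{2j-1}(x+s_jy)^d+\sum_{j=1}^{\nu-1}\lambda_{2j}(x-s_jy)^d+\lambda_{d-1}(x+sy)^d+\lambda_d(R_1x+R_2y)^d .$$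
   Context: Notation. For a polynomial $f$ in one variable with real coefficients, $\|f\|$ denotes the maximum of the absolute values of its coefficients. For a real or symbolic $t$, let $v(t)=(1,t,t^2,\dots,t^d)^t\in\mathbb{R}^{d+1}$ (column vector), let $e=(0,\dots,0,1)^t\in\mathbb{R}^{d+1}$, $\bar c=(c_d,c_{d-1},\dots,c_0)^t$ and $X=(X_0,\dots,X_d)^t$ with $X_0,\dots,X_d$ variables. Polynomials $\Delta_k$. If $d=2\nu+1$ is odd, let $V$ be the $(d+1)\times(d+1)$ matrix with columns $X,\,v(S_1),v(-S_1),\dots,v(S_\nu),v(-S_\nu),\,\bar c$, and write $\det V=\Delta_0X_0+\dots+\Delta_dX_d$ with $\Delta_k\in\mathbb{R}[S_1,\dots,S_\nu]$. If $d=2\nu$ is even, let $V$ be the matrix with columns $X,\,v(S),\,v(S_1),v(-S_1),\dots,v(S_{\nu-1}),v(-S_{\nu-1}),\,\bar c$, and write $\det V=\Delta_0X_0+\dots+\Delta_dX_d$ with $\Delta_k\in\mathbb{R}[S,S_1,\dots,S_{\nu-1}]$. Subroutine WDParameters_odd ($d=2\nu+1$). Put $s_i=i$ for $1\le i\le\nu-1$, and $D_d(S_\nu)=\Delta_d(s_1,\dots,s_{\nu-1},S_\nu)$, $D_{d-1}(S_\nu)=\Delta_{d-1}(s_1,\dots,s_{\nu-1},S_\nu)$. If $D_d\equiv0$: set delta $=0$, $m=\max\{\nu-1,\|D_{d-1}\|\}$, $s_\nu=2m+1$, and return $\mathbf{s}=(s_1,\dots,s_\nu,0)$ and delta. Otherwise: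 set delta $=1$; let $m$ be the maximum of $\nu-1$, $\|D_d\|$, $\|D_{d-1}-S_\nu D_d\|$, $\|D_{d-1}+S_\nu D_d\|$, and $\|D_{d-1}-s_iD_d\|$, $\|D_{d-1}+s_iD_d\|$ for $1\le i\le\nu-1$; set $s_\nu=2m+1$, $R=-D_{d-1}(s_\nu)/D_d(s_\nu)$, and return $\mathbf{s}=(s_1,\dots,s_\nu,R)$ and delta. Subroutine WDParameters_even ($d=2\nu$). Put $s_i=i$ for $1\le i\le\nu-1$, and $D_d(S)=\Delta_d(S,s_1,\dots,s_{\nu-1})$, $D_{d-1}(S)=\Delta_{d-1}(S,s_1,\dots,s_{\nu-1})$. If $D_d\equiv0$: set delta $=0$, $m=\max\{\nu-1,\|D_{d-1}\|\}$, $s=2m+1$, and return $\mathbf{s}=(s,s_1,\dots,s_{\nu-1},0)$ and delta. Otherwise: set delta $=1$; let $m$ be the maximum of $\nu-1$, $\|D_d\|$, $\|D_{d-1}+2SD_d\|$, and $\|D_{d-1}-(S+s_i)D_d\|$, $\|D_{d-1}+(S-s_i)D_d\|$ for $1\le i\le\nu-1$; set $s=2m+1$, $R=-D_{d-1}(s)/D_d(s)-s$, and return $\mathbf{s}=(s,s_1,\dots,s_{\nu-1},R)$ and delta. Algorithm RWD. Let $\nu$ and $\epsilon$ be the quotient and remainder of $d$ by $2$. Call the odd subroutine if $\epsilon=1$ and the even one if $\epsilon=0$, obtaining $\mathbf{s}$ (last entry denoted $s_{\nu+1}$) and delta. If delta $=1$ put $\mathbf{R}=(1,s_{\nu+1})$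 and $w=v(s_{\nu+1})$; if delta $=0$ put $\mathbf{R}=(0,1)$ and $w=e$. Let $M$ be the $(d+1)\times d$ matrix with columns $v(s_1),v(-s_1),\dots,v(s_\nu),v(-s_\nu),w$ if $\epsilon=1$, and $v(s),v(s_1),v(-s_1),\dots,v(s_{\nu-1}),v(-s_{\nu-1}),w$ if $\epsilon=0$. Let $\boldsymbol{\lambda}$ be the unique solution of $M\vec\lambda=\bar c$, its entries being listed in the order of the columns of $M$: $[\lambda_1,\dots,\lambda_d]$ if $\epsilon=1$, and $[\lambda_{d-1},\lambda_1,\dots,\lambda_{d-2},\lambda_d]$ if $\epsilon=0$. Return $[\epsilon,\mathbf{s},\mathbf{R},\boldsymbol{\lambda}]$.
   Formalization: RWD has no output for some nonzero real forms (D_d may vanish at the chosen s_ν or s, or R may equal another node), so the identities hold for any existing output; a unique output is proved when, if delta = 1, that denominator is nonzero and R differs from the other nodes. *)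

(* Defs.v *)
From HB Require Import structures.
From mathcomp Require Import all_boot all_order all_algebra.
From mathcomp Require Import mpoly.

Set Implicit Arguments.
Unset Strict Implicit.
Unset Printing Implicit Defensive.

Import Order.TTheory GRing.Theory Num.Theory.
Local Open Scope ring_scope.

(* The coefficient vector (c_0, ..., c_d) is a function 'I_d.+1 -> R; the     *)
(* variables x and y are 'X_0 and 'X_1.                                       *)
Definition binary_form (R : comNzRingType) (d : nat) (c : 'I_d.+1 -> R) :
    {mpoly R[2]} :=
  \sum_(i < d.+1) ('C(d, i)%:R * c i) *: ('X_0 ^+ i * 'X_1 ^+ (d - i)).

Definition vcol (A : nzRingType) (d : nat) (t : A) : 'cV[A]_d.+1 :=
  \col_i t ^+ i.

Definition ecol (A : nzRingType) (d : nat) : 'cV[A]_d.+1 :=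
  \col_i (i == ord_max)%:R.

Definition cbar (A : nzRingType) (d : nat) (c : 'I_d.+1 -> A) : 'cV[A]_d.+1 :=
  \col_i c (rev_ord i).

(* The arguments t of the columns v(t) occurring in V and in M, in order.     *)
(* For d odd the parameters are listed as [:: S_1; ...; S_nu], for d even as  *)
(* [:: S; S_1; ...; S_(nu-1)].                                                *)
Definition pm_nodes (A : nzRingType) (t : seq A) : seq A :=
  flatten [seq [:: x; - x] | x <- t].

Definition nodes (A : nzRingType) (d : nat) (t : seq A) : seq A :=
  if odd d then pm_nodes t else take 1 t ++ pm_nodes (behead t).

Section Delta.
Variables (R : comNzRingType) (d : nat) (c : 'I_d.+1 -> R).

(* The ring of the S-variables; 'X_j is S_(j+1) if d is odd, while 'X_0 is S  *)
(* and 'X_j is S_j (j > 0) if d is even.                                      *)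
Local Notation A := {mpoly R[d %/ 2]}.

Definition Snodes : seq A := nodes d [seq 'X_j | j <- enum 'I_(d %/ 2)].

Definition V : 'M[{mpoly A[d.+1]}]_d.+1 :=
  \matrix_(i, j)
    if j == 0 :> nat then 'X_i
    else if j == d :> nat then (cbar c i 0)%:MP%:MP
    else (vcol d (nth 0 Snodes j.-1) i 0)%:MP.

Definition Delta (k : 'I_d.+1) : A := (\det V)@_U_(k).

(* Delta_k with the S-variables replaced by the elements of the list t. *)
Definition Delta_subst (k : 'I_d.+1) (t : seq {poly R}) : {poly R} :=
  mmap (@polyC R) (fun j : 'I_(d %/ 2) => nth 0 t j) (Delta k).

End Delta.

Definition pnorm (R : realFieldType) (f : {poly R}) : R :=
  \big[Num.max/0]_(i < size f) `|f`_i|.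

(* The maximum of l, provided that its elements are nonnegative. *)
Definition seqmax (R : realFieldType) (l : seq R) : R :=
  \big[Num.max/0]_(x <- l) x.

Section RWD.
Variables (R : realFieldType) (d : nat) (c : 'I_d.+1 -> R).

Let nu : nat := (d %/ 2)%N.

(* s_1, ..., s_(nu-1) *)
Definition small_params : seq R := [seq i%:R | i <- iota 1 nu.-1].

(* Both subroutines return (s, delta). A division by zero in R yields 0; see  *)
(* RWD_regular.                                                               *)
Definition WDParameters_odd : seq R * bool :=
  let t := rcons [seq a%:P | a <- small_params] 'X in
  let Dd := Delta_subst c ord_max t in
  let Dd1 := Delta_subst c (inord d.-1) t in
  if Dd == 0 then
    let m := Num.max (nu.-1)%:R (pnorm Dd1) in
    let snu := 2%:R * m + 1 in
    (rcons (rcons small_params snu) 0, false)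
  else
    let m := seqmax
      ([:: (nu.-1)%:R; pnorm Dd; pnorm (Dd1 - 'X * Dd); pnorm (Dd1 + 'X * Dd)]
       ++ [seq pnorm (Dd1 - a *: Dd) | a <- small_params]
       ++ [seq pnorm (Dd1 + a *: Dd) | a <- small_params]) in
    let snu := 2%:R * m + 1 in
    (rcons (rcons small_params snu) (- Dd1.[snu] / Dd.[snu]), true).

Definition WDParameters_even : seq R * bool :=
  let t := 'X :: [seq a%:P | a <- small_params] in
  let Dd := Delta_subst c ord_max t in
  let Dd1 := Delta_subst c (inord d.-1) t in
  if Dd == 0 then
    let m := Num.max (nu.-1)%:R (pnorm Dd1) in
    let s := 2%:R * m + 1 in
    (s :: rcons small_params 0, false)
  else
    let m := seqmax
      ([:: (nu.-1)%:R; pnorm Dd; pnorm (Dd1 + 2%:R *: 'X * Dd)]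
       ++ [seq pnorm (Dd1 - ('X + a%:P) * Dd) | a <- small_params]
       ++ [seq pnorm (Dd1 + ('X - a%:P) * Dd) | a <- small_params]) in
    let s := 2%:R * m + 1 in
    (s :: rcons small_params (- Dd1.[s] / Dd.[s] - s), true).

Definition WDParameters : seq R * bool :=
  if (d %% 2 == 1)%N then WDParameters_odd else WDParameters_even.

Definition RWD_matrix (s : seq R) (delta : bool) : 'M[R]_(d.+1, d) :=
  let w := if delta then vcol d (last 0 s) else ecol R d in
  \matrix_(i, j)
    if (j < d.-1)%N then vcol d (nth 0 (nodes d (take nu s)) j) i 0
    else w i 0.

(* [epsilon, s, (R_1, R_2), lambda] is the output of the algorithm. The list  *)
(* lambda follows the order of the columns of the matrix.                     *)
Definition RWD_output (o : nat * seq R * (R * R) * seq R) : Prop :=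
  let: (s, delta) := WDParameters in
  exists2 lambda : 'cV[R]_d,
    unique (fun x : 'cV[R]_d => RWD_matrix s delta *m x = cbar c) lambda &
    o = ((d %% 2)%N, s, if delta then (1, last 0 s) else (0, 1),
         [seq lambda i 0 | i <- enum 'I_d]).

(* The run meets no degeneracy: if delta = 1, the denominator D_d(s_nu)       *)
(* (resp. D_d(s)) is nonzero and the last node s_(nu+1) differs from all      *)
(* the other ones. For real coefficients the choice of m does not ensure      *)
(* this.                                                                      *)
Definition RWD_regular : Prop :=
  let: (s, delta) := WDParameters in
  delta ->
    (Delta c ord_max).@[fun j : 'I_nu => nth 0 s j] != 0
    /\ last 0 s \notin nodes d (take nu s).

End RWD.

(* The entry named lambda_k (1 <= k <= d): the output list is                 *)
(* [lambda_1, ..., lambda_d] if epsilon = 1, and                              *)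
(* [lambda_(d-1), lambda_1, ..., lambda_(d-2), lambda_d] if epsilon = 0.      *)
Definition lambda_entry (R : nzRingType) (d eps : nat) (l : seq R) (k : nat) :
    R :=
  if eps == 1%N then nth 0 l k.-1
  else if k == d.-1 then nth 0 l 0
  else if k == d then nth 0 l d.-1
  else nth 0 l k.

(* Main.v *)
Require Import Defs.
From HB Require Import structures.
From mathcomp Require Import all_boot all_order all_algebra.
From mathcomp Require Import mpoly reals zify.

Set Implicit Arguments.
Unset Strict Implicit.
Unset Printing Implicit Defensive.

Import Order.TTheory GRing.Theory Num.Theory.
Local Open Scope ring_scope.

(** Comparing coefficients, p is the sum of the lambda_j (a_j x + b_j y)^d if
    and only if c_i is the sum of the lambda_j a_j^i b_j^(d-i) for every i;
    with (a, b) = (1, t) for a column v(t) and (a, b) = (0, 1) for the column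
    e these equations are exactly the rows of M lambda = cbar.  So the two
    displayed decompositions only unfold the linear system, once the columns
    of M are regrouped into the pairs v(s_j), v(-s_j).

    What needs an argument is that a regular run produces a system with exactly
    one solution.  The choice of the parameters makes the first d - 1 nodes
    distinct, because s_i = i while s_nu (or s) = 2 m + 1 exceeds all of these;
    regularity makes R distinct from them if w = v(R).  By Vandermonde the d
    columns of M are then independent, which gives uniqueness; existence
    follows as soon as the square matrix obtained by adjoining cbar to M is
    singular ([node_matrix_solvable]).  Up to a permutation of columns this
    matrix is V with w in place of X, so its determinant is the sum of the
    Delta_k w_k ([det_bordered_Delta]).

    If delta = 0, then w = e and the determinant is Delta_d, which vanishes
    because D_d is the zero polynomial.  If delta = 1, then w = v(R) and the
    determinant is F(R) for F(T) = Delta_0 + Delta_1 T + ... + Delta_d T^d.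
    This F has the d - 1 nodes as roots, since two columns of V then agree.
    Its remaining root is determined by Vieta: it is -Delta_(d-1)/Delta_d minus
    the sum of the nodes ([root_from_top_coefs]).  The nodes come in pairs of
    opposites, except for the single s when d is even, so their sum is 0 or s,
    and this remaining root is the R computed by the algorithm. *)

(** * Sums of powers of linear forms *)

(** The coefficients c_i of a form are normalised by the binomials so that, for
    the power of a linear form a x + b y, they are the monomials a^i b^(d-i). *)
Lemma binary_form_sum_powers (R : comNzRingType) (d n : nat)
    (c : 'I_d.+1 -> R) (lam a b : 'I_n -> R) :
  (forall i : 'I_d.+1, c i = \sum_j lam j * (a j ^+ i * b j ^+ (d - i))) ->
  binary_form c = \sum_j lam j *: (a j *: 'X_0 + b j *: 'X_1) ^+ d.
Proof.
move=> cE; rewrite /binary_form.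
have powE j : lam j *: (a j *: 'X_0 + b j *: 'X_1) ^+ d =
    \sum_(i < d.+1) ('C(d, i)%:R * (lam j * (a j ^+ i * b j ^+ (d - i))))
      *: ('X_0 ^+ i * 'X_1 ^+ (d - i)) :> {mpoly R[2]}.
  rewrite addrC exprDn_comm; last exact: mulrC.
  rewrite scaler_sumr; apply: eq_bigr => i _.
  rewrite !exprZn -scalerAl -scalerAr scalerA -scaler_nat !scalerA.
  rewrite ['X_1 ^+ _ * _]mulrC; congr (_ *: _).
  by rewrite [b j ^+ _ * _]mulrC -mulrA mulrCA.
rewrite (eq_bigr _ (fun j _ => powE j)) exchange_big /=.
by apply: eq_bigr => i _; rewrite -scaler_suml -mulr_sumr -cE.
Qed.

(** * The list of nodes *)

Lemma nth_map_additive (A B : nmodType) (f : {additive A -> B}) (t : seq A) k :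
  nth 0 (map f t) k = f (nth 0 t k).
Proof.
by elim: t k => [|x t IHt] [|k]; rewrite ?nth_nil ?raddf0 //=; apply: IHt.
Qed.

Section Nodes.

Variable A : nzRingType.
Implicit Types t : seq A.

Lemma size_pm_nodes t : size (pm_nodes t) = (size t).*2.
Proof. by elim: t => //= x t; rewrite /pm_nodes /= => ->. Qed.

Lemma nth_pm_nodes t k : nth 0 (pm_nodes t) k.*2 = nth 0 t k.
Proof.
by elim: t k => [|x t IHt] [|k]; rewrite ?nth_nil //=; apply: IHt.
Qed.

Lemma nth_pm_nodesN t k : nth 0 (pm_nodes t) k.*2.+1 = - nth 0 t k.
Proof.
by elim: t k => [|x t IHt] [|k]; rewrite ?nth_nil ?oppr0 //=; apply: IHt.
Qed.

Lemma size_nodes d t :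
  (1 < d)%N -> size t = (d %/ 2)%N -> size (nodes d t) = d.-1.
Proof.
move=> d_gt1 szt; rewrite /nodes; move: szt; rewrite divn2.
have := odd_double_half d; case: (odd d) => /= dE szt.
  by rewrite size_pm_nodes szt -{2}dE.
case: t szt => [|x t] /= szt; first by move: d_gt1; rewrite -dE -szt.
by rewrite take0 size_pm_nodes -[d in RHS]dE -szt doubleS.
Qed.

Lemma sum_pm_nodes t : \sum_(x <- pm_nodes t) x = 0.
Proof.
elim: t => [|x t IHt]; first by rewrite big_nil.
by rewrite /pm_nodes /= !big_cons IHt addr0 subrr.
Qed.

Lemma map_pm_nodes (B : nzRingType) (f : {additive A -> B}) t :
  map f (pm_nodes t) = pm_nodes (map f t).
Proof.
by elim: t => // x t IHt; rewrite /pm_nodes /= raddfN -/(pm_nodes t) IHt.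
Qed.

Lemma map_nodes (B : nzRingType) (f : {additive A -> B}) d t :
  map f (nodes d t) = nodes d (map f t).
Proof.
by rewrite /nodes; case: ifP; rewrite ?map_cat -?map_take ?map_pm_nodes
  -?behead_map.
Qed.

End Nodes.

(** * The determinant of V *)

(** The matrix V with an arbitrary first column u in place of the variables X_k,
    over an arbitrary ring: the same shape serves over the ring of the
    S-variables and, after evaluation, over the field. *)
Definition bordered (A : nzRingType) (d : nat) (u b : 'cV[A]_d.+1)
    (ts : seq A) : 'M[A]_d.+1 :=
  \matrix_(i, j)
    if j == 0 :> nat then u i 0
    else if j == d :> nat then b i 0
    else nth 0 ts j.-1 ^+ i.

(** Cofactors along the first column do not see that column. *)
Lemma cofactor_bordered_irr (A : comNzRingType) d (u u' b : 'cV[A]_d.+1) ts k :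
  cofactor (bordered u b ts) k ord0 = cofactor (bordered u' b ts) k ord0.
Proof.
by congr (_ * \det _); apply/matrixP => i j; rewrite !mxE.
Qed.

Lemma map_bordered (A B : comNzRingType) (f : {rmorphism A -> B}) d
    (u b : 'cV[A]_d.+1) ts :
  map_mx f (bordered u b ts) =
  bordered (map_mx f u) (map_mx f b) (map f ts).
Proof.
apply/matrixP => i j; rewrite !mxE; case: ifP => // _; case: ifP => // _.
by rewrite nth_map_additive rmorphXn.
Qed.

Section DeltaEval.

Variables (R : comNzRingType) (d : nat) (c : 'I_d.+1 -> R).

(** The determinant of V, expanded along its first column, is the sum of the X_k
    times cofactors which are constant in the X_k; so the coefficient of X_k is
    the k-th cofactor. *)
Lemma Delta_cofactor k :
  Delta c k =
  cofactor (bordered 0 (map_mx (@mpolyC _ R) (cbar c)) (Snodes R d)) k ord0.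
Proof.
set W := bordered _ _ _.
have VE : V c = bordered (\col_i 'X_i) (map_mx (@mpolyC d.+1 _)
    (map_mx (@mpolyC _ R) (cbar c))) (map (@mpolyC _ _) (Snodes R d)).
  apply/matrixP => i j; rewrite !mxE; case: ifP => // _; case: ifP => // _.
  by rewrite nth_map_additive rmorphXn.
have cofE i : cofactor (V c) i ord0 = (cofactor W i ord0)%:MP.
  by rewrite -cofactor_map_mx map_bordered VE; apply: cofactor_bordered_irr.
rewrite /Delta (expand_det_col _ ord0) raddf_sum /= (bigD1 k) //=.
rewrite big1 => [|i neq_ik].
  by rewrite addr0 cofE mulrC mcoeffCM VE !mxE mcoeffXU eqxx mulr1.
by rewrite cofE mulrC mcoeffCM VE !mxE mcoeffXU (negPf neq_ik) mulr0.
Qed.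

Lemma Delta_eval (s : 'I_(d %/ 2) -> R) (u : 'cV_d.+1) k :
  (Delta c k).@[s] =
  cofactor (bordered u (cbar c) (nodes d (map s (enum 'I_(d %/ 2))))) k ord0.
Proof.
rewrite Delta_cofactor -cofactor_map_mx map_bordered.
rewrite (cofactor_bordered_irr _ u) -map_mx_comp.
congr (cofactor (bordered _ _ _) _ _).
  by apply/matrixP => i j; rewrite !mxE /= mevalC.
rewrite map_nodes -map_comp; congr (nodes _ _).
by apply: eq_map => i /=; rewrite mevalXU.
Qed.

(** Evaluation is a ring morphism, hence commutes with the determinant of V. *)
Lemma det_bordered_Delta (s : 'I_(d %/ 2) -> R) (u : 'cV_d.+1) :
  \det (bordered u (cbar c) (nodes d (map s (enum 'I_(d %/ 2))))) =
  \sum_k (Delta c k).@[s] * u k 0.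
Proof.
rewrite (expand_det_col _ ord0); apply: eq_bigr => k _.
by rewrite (Delta_eval s u) mulrC mxE.
Qed.

(** The subroutines work with the one-variable polynomials D_d and D_(d-1), while
    the determinant involves Delta_d and Delta_(d-1) at all the parameters. *)
Lemma horner_Delta_subst k (t : seq {poly R}) x :
  (Delta_subst c k t).[x] = (Delta c k).@[fun j => (nth 0 t j).[x]].
Proof.
rewrite /Delta_subst /mmap mevalE horner_sum; apply: eq_bigr => m _.
rewrite hornerM hornerC; congr (_ * _).
rewrite /mmap1 horner_prod; apply: eq_bigr => i _.
by rewrite horner_exp.
Qed.

End DeltaEval.

(** * Vandermonde systems and Vieta's formula *)

Lemma geometric_columns_free (F : fieldType) n (t a : 'I_n -> F) :
  injective t -> (forall i : 'I_n, \sum_j a j * t j ^+ i = 0) ->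
  forall j, a j = 0.
Proof.
move=> t_inj a0 j.
pose tr := \row_j t j; pose M := Vandermonde n tr.
have Mu : M \in unitmx.
  rewrite unitmxE unitfE det_Vandermonde.
  apply/prodf_neq0 => i _; apply/prodf_neq0 => k lt_ik; rewrite !mxE subr_eq0.
  by apply: contraTneq lt_ik => /t_inj ->; rewrite ltnn.
have Ma : M *m (\col_j a j) = 0.
  apply/colP => i; rewrite !mxE -[RHS](a0 i); apply: eq_bigr => k _.
  by rewrite !mxE mulrC.
by have /colP/(_ j) := mulKmx Mu (\col_j a j); rewrite Ma mulmx0 !mxE.
Qed.

(** A polynomial of degree at most n + 1 with n known roots t is a linear factor
    times the product of the X - t, and its two top coefficients determine the
    linear factor.  The hypothesis on r says that r is a root of this factor. *)
Lemma root_from_top_coefs (F : fieldType) (p : {poly F}) ts r :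
  ts != [::] -> uniq ts -> all (root p) ts -> (size p <= (size ts).+2)%N ->
  p`_(size ts).+1 * (r + \sum_(t <- ts) t) + p`_(size ts) = 0 ->
  root p r.
Proof.
move=> ts_n0 uts rts szp top0.
have /dvdpP[q pE] : \prod_(z <- ts) ('X - z%:P) %| p.
  by apply: uniq_roots_dvdp; rewrite ?uniq_rootsE.
set P := \prod_(_ <- _) _ in pE.
have Pmon : P \is monic by apply: monic_prod_XsubC.
have szP : size P = (size ts).+1 by apply: size_prod_XsubC.
have szq : (size q <= 2)%N.
  have [->|q_n0] := eqVneq q 0; first by rewrite size_poly0.
  move: szp; rewrite pE size_Mmonic // szP addnS /=.
  by rewrite -(addn2 (size ts)) addnC leq_add2l.
have qE : q = q`_1 *: 'X + (q`_0)%:P.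
  apply/polyP => i; rewrite coefD coefZ coefX coefC.
  case: i => [|[|i]] /=; rewrite ?mulr0 ?mulr1 ?add0r ?addr0 //.
  by rewrite nth_default // (leq_trans szq).
have Pn : P`_(size ts) = 1 by have/eqP := Pmon; rewrite lead_coefE szP.
have Pn1 : P`_(size ts).-1 = - \sum_(t <- ts) t.
  by apply: coefPn_prod_XsubC; rewrite size_eq0.
have coefp k : p`_k.+1 = q`_1 * P`_k + q`_0 * P`_k.+1.
  by rewrite pE [in LHS]qE mulrDl coefD -scalerAl coefZ coefXM mul_polyC coefZ.
have szE : (size ts).-1.+1 = size ts by rewrite prednK // lt0n size_eq0.
have pn : p`_(size ts) = q`_0 - q`_1 * \sum_(t <- ts) t.
  by rewrite -[in LHS]szE coefp szE Pn1 Pn mulr1 mulrN addrC.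
have pn1 : p`_(size ts).+1 = q`_1.
  by rewrite coefp Pn [P`_ _]nth_default ?szP // mulr1 mulr0 addr0.
move: top0; rewrite pn pn1 mulrDr addrACA subrr addr0 => qr0.
by rewrite pE /root hornerM qE hornerD hornerZ hornerX hornerC qr0 mul0r.
Qed.

(** * Solvability of the linear system *)

Section NodeMatrix.

Variable F : fieldType.

Definition node_matrix d (ts : seq F) (w : 'cV[F]_d.+1) : 'M[F]_(d.+1, d) :=
  \matrix_(i, j) if (j < d.-1)%N then nth 0 ts j ^+ i else w i 0.

Lemma node_matrix_vcol_inj d (ts : seq F) x (a : 'cV_d) :
  size ts = d.-1 -> uniq (rcons ts x) -> node_matrix ts (vcol d x) *m a = 0 ->
  a = 0.
Proof.
case: d a => [|n] a szts uts Ma; first by apply/colP => -[].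
have szr : size (rcons ts x) = n.+1 by rewrite size_rcons szts.
pose t (j : 'I_n.+1) := nth 0 (rcons ts x) j.
have t_inj : injective t.
  by move=> j k /eqP; rewrite nth_uniq ?szr // => /eqP /val_inj.
apply/colP => j; rewrite [RHS]mxE.
apply: (geometric_columns_free (a := fun j => a j 0) t_inj) => i.
have /colP/(_ (widen_ord (leqnSn _) i)) := Ma; rewrite !mxE; apply: etrans.
apply: eq_bigr => k _; rewrite !mxE mulrC /t nth_rcons szts /=.
have: (k <= n)%N by rewrite -ltnS ltn_ord.
rewrite leq_eqVlt.
by case/predU1P=> [->|->]; rewrite ?ltnn ?eqxx.
Qed.

(** The column e only affects the last row; the other rows already force the
    coefficients of the node columns to vanish. *)
Lemma node_matrix_ecol_inj d (ts : seq F) (a : 'cV_d) :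
  size ts = d.-1 -> uniq ts -> node_matrix ts (ecol F d) *m a = 0 ->
  a = 0.
Proof.
case: d a => [|n] a szts uts Ma; first by apply/colP => -[].
pose t (j : 'I_n) := nth 0 ts j.
have t_inj : injective t.
  by move=> j k /eqP; rewrite nth_uniq ?szts // => /eqP /val_inj.
have rowE (i : 'I_n.+2) :
    \sum_(j < n) a (widen_ord (leqnSn _) j) 0 * t j ^+ i +
    (i == ord_max)%:R * a ord_max 0 = 0.
  have /colP/(_ i) := Ma; rewrite !mxE big_ord_recr /=; apply: etrans.
  congr (_ + _); last by rewrite !mxE /= ltnn.
  by apply: eq_bigr => j _; rewrite !mxE /= ltn_ord mulrC.
have a0 j : a (widen_ord (leqnSn _) j) 0 = 0.
  apply: (geometric_columns_free (a := fun j => a (widen_ord _ j) 0) t_inj) => i.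
  have := rowE (widen_ord (leqW (leqnSn _)) i).
  by rewrite -val_eqE /= ltn_eqF ?mul0r ?addr0 // ltnS ltnW.
apply/colP => j; rewrite [RHS]mxE.
have [lt_jn|ge_jn] := ltnP j n.
  by rewrite -(a0 (Ordinal lt_jn)); congr (a _ 0); apply: val_inj.
have -> : j = ord_max.
  by apply: val_inj; apply/eqP; rewrite eqn_leq ge_jn -ltnS ltn_ord.
have := rowE ord_max; rewrite eqxx mul1r big1 ?add0r // => k _.
by rewrite a0 mul0r.
Qed.

(** Singularity of the bordered matrix gives a linear relation between w, the
    node columns and b; by independence of the first d columns, b occurs in it with a
    nonzero coefficient and can be solved for. *)
Lemma node_matrix_solvable d (ts : seq F) (w b : 'cV_d.+1) :
  (0 < d)%N -> \det (bordered w b ts) = 0 ->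
  (forall a : 'cV_d, node_matrix ts w *m a = 0 -> a = 0) ->
  exists lam, unique (fun a : 'cV_d => node_matrix ts w *m a = b) lam.
Proof.
case: d w b => // n w b _ /eqP; rewrite -det_tr => /det0P[v v_n0 vB] inj.
(* The bordered matrix has w in front, the matrix of the system has it last. *)
pose a : 'cV_n.+1 :=
  \col_(j < n.+1) v 0 (if (j < n)%N then lift ord0 j else ord0).
have Ma : node_matrix ts w *m a = - v 0 ord_max *: b.
  apply/colP => i; apply/eqP; rewrite -subr_eq0 !mxE mulNr opprK.
  have /rowP/(_ i) := vB; rewrite !mxE big_ord_recl big_ord_recr /= => vBi.
  rewrite -[X in _ == X]vBi big_ord_recr /= !mxE /= ltnn.
  rewrite eqxx [in X in _ == X]addrCA [in X in _ == X]addrA /=.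
  apply/eqP; congr (_ + _ + _).
  - apply: eq_bigr => j _; rewrite !mxE lift0 /= ltn_ord mulrC.
    by rewrite eqSS ltn_eqF.
  - exact: mulrC.
  - by congr (v 0 _ * _); apply: val_inj.
have vmax_n0 : v 0 ord_max != 0.
  apply: contraNneq v_n0 => vmax0.
  have a0 : a = 0 by apply: inj; rewrite Ma vmax0 oppr0 scale0r.
  have v0E (j : 'I_n.+1) : v 0 (if (j < n)%N then lift ord0 j else ord0) = 0.
    by have /colP/(_ j) := a0; rewrite !mxE.
  apply/eqP/rowP => k; rewrite [RHS]mxE; case: (unliftP ord0 k) => [j ->|->].
    have [lt_jn|ge_jn] := ltnP j n; first by have := v0E j; rewrite lt_jn.
    rewrite -[RHS]vmax0; congr (v 0 _); apply: val_inj; rewrite /= /bump add1n.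
    by congr _.+1; apply/eqP; rewrite eqn_leq ge_jn -ltnS ltn_ord.
  by have := v0E ord_max; rewrite /= ltnn.
have lamP : node_matrix ts w *m (- (v 0 ord_max)^-1 *: a) = b.
  by rewrite -scalemxAr Ma scalerA mulrNN mulVf // scale1r.
exists (- (v 0 ord_max)^-1 *: a); split=> // a' Ma'.
by apply/eqP; rewrite -subr_eq0; apply/eqP/inj; rewrite mulmxBr lamP Ma' subrr.
Qed.

End NodeMatrix.

(** * The parameters chosen by the subroutines *)

Section DistinctNodes.

Variable R : realFieldType.
Implicit Types t : seq R.

Lemma mem_pm_nodes t x : (x \in pm_nodes t) = (x \in t) || (- x \in t).
Proof.
elim: t => // y t IHt; rewrite /pm_nodes /= !inE -/(pm_nodes t) IHt.
by rewrite eqr_oppLR; do !case: (_ == _) => //=; rewrite ?orbT.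
Qed.

Lemma uniq_pm_nodes t : uniq t -> all (fun x => 0 < x) t -> uniq (pm_nodes t).
Proof.
elim: t => // x t IHt /= /andP[x_t ut] /andP[x_gt0 t_gt0].
have Nx_t : - x \notin t.
  by apply/negP => /(allP t_gt0); rewrite oppr_gt0 ltNge ltW.
rewrite /pm_nodes /= -/(pm_nodes t) IHt // inE !mem_pm_nodes opprK.
rewrite (negPf x_t) (negPf Nx_t) /= orbF andbT.
by rewrite gt_eqF // gtrN.
Qed.

Lemma uniq_small_params d : uniq (small_params R d).
Proof.
by rewrite map_inj_uniq ?iota_uniq // => i j /eqP; rewrite eqr_nat => /eqP.
Qed.

Lemma small_params_bounds d x :
  x \in small_params R d -> 0 < x <= ((d %/ 2).-1)%:R.
Proof.
by case/mapP=> i; rewrite mem_iota add1n ltnS => /andP[i_gt0 le_i] ->;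
  rewrite ltr0n i_gt0 ler_nat.
Qed.

Lemma size_small_params d : size (small_params R d) = (d %/ 2).-1.
Proof. by rewrite size_map size_iota. Qed.

(** Every value of m is at least nu - 1, so 2 m + 1 exceeds all the small
    parameters; positivity then keeps the opposites distinct as well. *)
Lemma large_param_fresh d (m : R) : ((d %/ 2).-1)%:R <= m ->
  uniq (2%:R * m + 1 :: small_params R d) /\
  all (fun x => 0 < x) (2%:R * m + 1 :: small_params R d).
Proof.
move=> le_m; have m_ge0 : 0 <= m by apply: le_trans le_m; apply: ler0n.
have lt_m : m < 2%:R * m + 1.
  by rewrite mulr_natl mulr2n -addrA ltrDl ltr_wpDl.
split=> /=; apply/andP; split.
- apply/negP => /small_params_bounds/andP[_ le_s].
  by have := le_lt_trans (le_trans le_s le_m) lt_m; rewrite ltxx.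
- exact: uniq_small_params.
- exact: le_lt_trans lt_m.
- by apply/allP => x /small_params_bounds/andP[].
Qed.

Lemma head_le_seqmax x (l : seq R) : x <= seqmax (x :: l).
Proof. by rewrite /seqmax big_cons le_max lexx. Qed.

End DistinctNodes.

(** This is why the odd subroutine returns -D_(d-1)/D_d, while the even one
    subtracts s. *)
Lemma sum_nodes (A : nzRingType) d (t : seq A) :
  \sum_(x <- nodes d t) x = if odd d then 0 else nth 0 t 0.
Proof.
rewrite /nodes; case: ifP => _; first exact: sum_pm_nodes.
rewrite big_cat /= sum_pm_nodes addr0.
by case: t => [|x t]; rewrite /= ?take0 ?big_seq1 ?big_nil.
Qed.

Section Subroutines.

Variables (R : realFieldType) (d : nat) (c : 'I_d.+1 -> R).
Hypothesis d_gt1 : (1 < d)%N.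
Let nu := (d %/ 2)%N.

(** What solvability needs to know about the output of the subroutines, in a form
    common to both parities. *)
Definition admissible (s : seq R) (delta : bool) : Prop :=
  let ev k := (Delta c k).@[fun j : 'I_nu => nth 0 s j] in
  let ts := nodes d (take nu s) in
  [/\ (nu <= size s)%N, uniq ts &
      if delta then last 0 s = - ev (inord d.-1) / ev ord_max - \sum_(t <- ts) t
      else ev ord_max = 0].

Lemma Delta_subst_eval k (t : seq {poly R}) s x :
  (forall j, (j < nu)%N -> (nth 0 t j).[x] = nth 0 s j) ->
  (Delta_subst c k t).[x] = (Delta c k).@[fun j : 'I_nu => nth 0 s j].
Proof.
by move=> ts; rewrite horner_Delta_subst; apply: meval_eq => j; apply: ts.
Qed.

Lemma nu_gt0 : (0 < nu)%N.
Proof. by rewrite divn_gt0. Qed.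

Lemma small_polyE (j : nat) x :
  (nth 0 [seq a%:P | a <- small_params R d] j).[x] = nth 0 (small_params R d) j.
Proof. by rewrite nth_map_additive hornerC. Qed.

Lemma WDParameters_odd_admissible : odd d ->
  admissible (WDParameters_odd c).1 (WDParameters_odd c).2.
Proof.
move=> d_odd; rewrite /WDParameters_odd.
set t := rcons _ 'X.
have szs m : size (rcons (small_params R d) m) = nu.
  by rewrite size_rcons size_small_params prednK ?nu_gt0.
have tE x r j : (j < nu)%N ->
    (nth 0 t j).[x] = nth 0 (rcons (rcons (small_params R d) x) r) j.
  move=> lt_j; rewrite [RHS]nth_rcons szs lt_j !nth_rcons size_map.
  case: ifP => _; first exact: small_polyE.
  by case: ifP => _; rewrite ?hornerX ?horner0.
have takeE x r : take nu (rcons (rcons (small_params R d) x) r) =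
    rcons (small_params R d) x.
  by rewrite -[X in take X _](szs x) -[rcons _ r]cats1 take_size_cat.
have common m r : nu.-1%:R <= m ->
  uniq (nodes d (take nu (rcons (rcons (small_params R d) (2%:R * m + 1)) r))).
  move=> /large_param_fresh[um pm]; rewrite takeE /nodes d_odd.
  by apply: uniq_pm_nodes; rewrite ?rcons_uniq ?all_rcons.
case: ifPn => [/eqP D0|_] /=; split.
- by rewrite size_rcons szs.
- by apply: common; rewrite le_max lexx.
- by rewrite -(Delta_subst_eval _ (tE _ _)) D0 horner0.
- by rewrite size_rcons szs.
- exact/common/head_le_seqmax.
- by rewrite last_rcons sum_nodes d_odd subr0 -!(Delta_subst_eval _ (tE _ _)).
Qed.

Lemma WDParameters_even_admissible : ~~ odd d ->
  admissible (WDParameters_even c).1 (WDParameters_even c).2.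
Proof.
move=> d_even; rewrite /WDParameters_even.
set t := _ :: _.
have szs m : size (m :: small_params R d) = nu.
  by rewrite /= size_small_params prednK ?nu_gt0.
have tE x r j : (j < nu)%N ->
    (nth 0 t j).[x] = nth 0 (x :: rcons (small_params R d) r) j.
  move=> lt_j; rewrite -rcons_cons [RHS]nth_rcons szs lt_j.
  by case: j {lt_j} => [|j] /=; rewrite ?hornerX ?small_polyE.
have takeE x r : take nu (x :: rcons (small_params R d) r) =
    x :: small_params R d.
  by rewrite -rcons_cons -[X in take X _](szs x) -cats1 take_size_cat.
have common m r : nu.-1%:R <= m ->
  uniq (nodes d (take nu (2%:R * m + 1 :: rcons (small_params R d) r))).
  move=> /large_param_fresh[um pm]; rewrite takeE /nodes (negPf d_even).
  have := uniq_pm_nodes um pm; rewrite /pm_nodes /= inE negb_or take0 /=.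
  by case/andP => /andP[_ ->] /andP[].
case: ifPn => [/eqP D0|_] /=; split.
- by rewrite /= size_rcons size_small_params prednK ?nu_gt0.
- by apply: common; rewrite le_max lexx.
- by rewrite -(Delta_subst_eval _ (tE _ _)) D0 horner0.
- by rewrite /= size_rcons size_small_params prednK ?nu_gt0.
- exact/common/head_le_seqmax.
- rewrite /= last_rcons sum_nodes (negPf d_even) takeE.
  by rewrite -!(Delta_subst_eval _ (tE _ _)).
Qed.

Lemma WDParameters_admissible : let: (s, delta) := WDParameters c in
  admissible s delta.
Proof.
rewrite /WDParameters modn2 eqb1; case: ifPn => [/WDParameters_odd_admissible|].
  by case: WDParameters_odd.
by move/WDParameters_even_admissible; case: WDParameters_even.
Qed.

End Subroutines.

(** * Regular runs *)

Lemma det_bordered_vcol_node (A : comNzRingType) d (b : 'cV[A]_d.+1) ts t :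
  size ts = d.-1 -> t \in ts -> \det (bordered (vcol d t) b ts) = 0.
Proof.
move=> szts t_ts; have lt_t : (index t ts < d.-1)%N by rewrite -szts index_mem.
have lt_td : ((index t ts).+1 < d.+1)%N.
  by rewrite ltnS (leq_trans lt_t) ?leq_pred.
rewrite -det_tr.
apply: (@determinant_alternate _ _ _ ord0 (Ordinal lt_td)) => // i.
rewrite !mxE /= ltn_eqF ?nth_index //.
by case: d lt_t {b szts lt_td i}.
Qed.

Section Solvability.

Variables (R : realFieldType) (d : nat) (c : 'I_d.+1 -> R).
Hypothesis d_gt1 : (1 < d)%N.
Let nu := (d %/ 2)%N.

Lemma det_bordered_nodes s (u : 'cV_d.+1) : (nu <= size s)%N ->
  \det (bordered u (cbar c) (nodes d (take nu s))) =
  \sum_k (Delta c k).@[fun j : 'I_nu => nth 0 s j] * u k 0.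
Proof.
move=> szs; rewrite -det_bordered_Delta.
congr (\det (bordered _ _ (nodes d _))).
by rewrite -(map_nth_iota0 0 szs) -val_enum_ord -map_comp.
Qed.

(** As a function of x, the determinant with first column v(x) is a polynomial of
    degree at most d having the d - 1 nodes as roots; the last parameter is its
    remaining root. *)
Lemma det_bordered_last s : admissible c s true ->
  (Delta c ord_max).@[fun j : 'I_nu => nth 0 s j] != 0 ->
  \det (bordered (vcol d (last 0 s)) (cbar c) (nodes d (take nu s))) = 0.
Proof.
pose ev k := (Delta c k).@[fun j : 'I_nu => nth 0 s j].
set ts := nodes d _; rewrite -/(ev ord_max) => -[szs uts lastE] D_n0.
have szts : size ts = d.-1 by apply: size_nodes => //; rewrite size_takel.
pose F := \poly_(i < d.+1) ev (inord i).
have FE x : F.[x] = \det (bordered (vcol d x) (cbar c) ts).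
  rewrite det_bordered_nodes // horner_poly; apply: eq_bigr => i _.
  by rewrite inord_val mxE.
have d1E : d.-1.+1 = d by rewrite prednK // ltnW.
rewrite -FE; apply/rootP/(@root_from_top_coefs _ _ ts) => //.
- by rewrite -size_eq0 szts -lt0n -subn1 subn_gt0.
- by apply/allP => t t_ts; rewrite /root FE det_bordered_vcol_node.
- by rewrite szts d1E size_poly.
- rewrite szts d1E !coef_poly ltnSn ltnS leq_pred lastE subrK.
  have -> : inord d = ord_max :> 'I_d.+1 by apply: val_inj; rewrite /= inordK.
  by rewrite mulrC mulrVK ?unitfE // addNr.
Qed.

Lemma RWD_system_solvable s (delta : bool) : admissible c s delta ->
  (delta -> (Delta c ord_max).@[fun j : 'I_nu => nth 0 s j] != 0
            /\ last 0 s \notin nodes d (take nu s)) ->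
  exists lam, unique (fun x : 'cV_d => RWD_matrix d s delta *m x = cbar c) lam.
Proof.
move=> adm reg; have [szs uts evE] := adm.
have szts : size (nodes d (take nu s)) = d.-1.
  by apply: size_nodes => //; rewrite size_takel.
have -> : RWD_matrix d s delta = node_matrix (nodes d (take nu s))
    (if delta then vcol d (last 0 s) else ecol R d).
  by apply/matrixP => i j; rewrite !mxE.
apply: node_matrix_solvable; first exact: ltnW.
- case: delta {evE} adm reg => [adm /(_ isT)[D_n0 _]|adm _].
    exact: det_bordered_last.
  case: adm => _ _ D0.
  rewrite det_bordered_nodes // (bigD1 ord_max) //= D0 mul0r.
  by rewrite add0r big1 // => k k_n; rewrite mxE (negPf k_n) mulr0.
- case: delta {evE adm} reg => [/(_ isT)[_ fresh]|_] a.
    by apply: node_matrix_vcol_inj => //; rewrite rcons_uniq fresh.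
  exact: node_matrix_ecol_inj.
Qed.

Lemma RWD_regular_output : RWD_regular c -> exists! o, RWD_output c o.
Proof.
have := WDParameters_admissible c d_gt1.
rewrite /RWD_regular /RWD_output; case: WDParameters => s delta adm reg.
have [lam lamP] := RWD_system_solvable adm reg.
eexists; split; first by exists lam.
move=> o [lam' [lam'P _] ->]; case: lamP => _ /(_ _ lam'P) ->.
by [].
Qed.

End Solvability.

(** * Reading off the decomposition *)

Lemma sum_even_odd (V : nmodType) (f : nat -> V) n :
  \sum_(i < n.*2) f i = \sum_(j < n) f j.*2 + \sum_(j < n) f j.*2.+1.
Proof.
rewrite -big_split /=; elim: n => [|n IHn]; first by rewrite !big_ord0.
by rewrite doubleS !big_ord_recr /= IHn -addrA.
Qed.

(** Row i of the system gives the coefficient c_(d-i), because cbar lists the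
    coefficients backwards; reversing i turns the system into the hypothesis of
    [binary_form_sum_powers]. *)
Lemma RWD_output_waring (R : realFieldType) d (c : 'I_d.+1 -> R) eps s R1 R2 l :
  (1 < d)%N -> RWD_output c (eps, s, (R1, R2), l) ->
  eps = odd d /\
  binary_form c =
    \sum_(j < d.-1) l`_j *:
      ('X_0 + (nodes d (take (d %/ 2) s))`_j *: 'X_1) ^+ d
    + l`_d.-1 *: (R1 *: 'X_0 + R2 *: 'X_1) ^+ d.
Proof.
case: d c => // n c _; rewrite /RWD_output; case: WDParameters => s' delta.
case=> lam [Mlam _] [-> -> R12 ->]; split; first exact: modn2.
set ts := nodes _ _.
pose ab (j : 'I_n.+1) := if (j < n)%N then (1, ts`_j) else (R1, R2).
rewrite (@binary_form_sum_powers _ _ _ c (fun j => lam j 0)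
  (fun j => (ab j).1) (fun j => (ab j).2)).
  rewrite big_ord_recr /= /ab ltnn /=.
  have nthE (j : 'I_n.+1) : [seq lam i 0 | i <- enum 'I_n.+1]`_j = lam j 0.
    by rewrite (nth_map j) ?size_enum_ord // nth_ord_enum.
  congr (_ + _ *: _); last by rewrite -nthE.
  by apply: eq_bigr => j _; rewrite ltn_ord scale1r -nthE.
move=> i; have /colP/(_ (rev_ord i)) := Mlam; rewrite [RHS]mxE rev_ordK => <-.
rewrite mxE; apply: eq_bigr => j _; rewrite !mxE mulrC /ab /=.
case: ifP => _; first by rewrite expr1n mul1r subSS.
congr (_ * _); case: delta {Mlam} R12 => -[-> ->].
  by rewrite !mxE expr1n mul1r /= subSS.
rewrite !mxE /= expr1n mulr1 expr0n -val_eqE /= subSS.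
by have := ltn_ord i; rewrite ltnS => le_i; congr (_%:R); apply/eqP/eqP; lia.
Qed.

Theorem theorem3p11 (R : realType) (d : nat) (c : 'I_d.+1 -> R)
  (hd : (1 < d)%N) (hp : binary_form c != 0) :
  (forall (eps : nat) (s : seq R) (R1 R2 : R) (l : seq R),
     RWD_output c (eps, s, (R1, R2), l) ->
     let nu := (d %/ 2)%N in
     let x : {mpoly R[2]} := 'X_0 in
     let y : {mpoly R[2]} := 'X_1 in
     let lam := lambda_entry d eps l in
     (eps = 1%N ->
        let s_ (j : nat) := nth 0 s j.-1 in
        binary_form c =
          \sum_(1 <= j < nu.+1) lam (2 * j).-1 *: (x + s_ j *: y) ^+ d
          + \sum_(1 <= j < nu.+1) lam (2 * j)%N *: (x - s_ j *: y) ^+ d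
          + lam d *: (R1 *: x + R2 *: y) ^+ d)
     /\
     (eps = 0%N ->
        let s0 := nth 0 s 0 in
        let s_ (j : nat) := nth 0 s j in
        binary_form c =
          \sum_(1 <= j < nu) lam (2 * j).-1 *: (x + s_ j *: y) ^+ d
          + \sum_(1 <= j < nu) lam (2 * j)%N *: (x - s_ j *: y) ^+ d
          + lam d.-1 *: (x + s0 *: y) ^+ d
          + lam d *: (R1 *: x + R2 *: y) ^+ d))
  /\ (RWD_regular c -> exists! o, RWD_output c o).
Proof.
split; last exact: RWD_regular_output.
move=> eps s R1 R2 l /(RWD_output_waring hd)[epsE ->] nu x y lam.
have nuE : (odd d + nu.*2 = d)%N by rewrite /nu divn2 odd_double_half.
have nu_n0 : (0 < nu)%N by rewrite divn_gt0.
split=> eps_b; rewrite eps_b in epsE.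
- have d_odd : odd d by case: (odd d) epsE.
  move=> s_; congr (_ + _); last by rewrite /lam /lambda_entry eps_b.
  have d1E : d.-1 = nu.*2 by rewrite -nuE d_odd.
  rewrite d1E (sum_even_odd (fun j =>
    l`_j *: (x + (nodes d (take (d %/ 2) s))`_j *: y) ^+ d)).
  rewrite !big_add1 !big_mkord; congr (_ + _); apply: eq_bigr => j _.
  + rewrite mul2n doubleS /lam /lambda_entry eps_b /= /nodes d_odd.
    by rewrite nth_pm_nodes nth_take.
  + rewrite mul2n doubleS /lam /lambda_entry eps_b /= /nodes d_odd.
    by rewrite nth_pm_nodesN nth_take // scaleNr.
- have d_even : odd d = false by case: (odd d) epsE.
  move=> s0 s_; move: nuE; rewrite d_even add0n => nuE.
  have lamE k : (k < d.-1)%N -> lam k = l`_k.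
    move=> lt_k; rewrite /lam /lambda_entry eps_b /= !ltn_eqF //.
    by rewrite (leq_trans lt_k) ?leq_pred.
  have -> : lam d = l`_d.-1.
    by rewrite /lam /lambda_entry eps_b /= eqxx gtn_eqF //; lia.
  have -> : lam d.-1 = l`_0 by rewrite /lam /lambda_entry eps_b /= eqxx.
  have nodesS k :
      (nodes d (take nu s))`_k.+1 = (pm_nodes (behead (take nu s)))`_k.
    rewrite /nodes d_even; case: (take nu s) => [|z t] /=.
      by rewrite !nth_nil.
    by rewrite take0.
  congr (_ + _).
  have d1E : d.-1 = (nu.-1).*2.+1 by rewrite -nuE -{1}(prednK nu_n0).
  rewrite d1E big_ord_recl addrC /=.
  rewrite (sum_even_odd (fun j =>
    l`_j.+1 *: (x + (nodes d (take (d %/ 2) s))`_j.+1 *: y) ^+ d)).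
  rewrite !big_add1 !big_mkord; congr (_ + _ + _); last first.
    rewrite /nodes d_even -/nu -(prednK nu_n0) /s0.
    by case: (s) => [|z s1]; rewrite /= ?take0.
  + apply: eq_bigr => j _; rewrite mul2n doubleS lamE /=; last first.
      by have := ltn_ord j; rewrite d1E; lia.
    by rewrite nodesS // nth_pm_nodesN scaleNr nth_behead nth_take //
       -ltn_predRL.
  + apply: eq_bigr => j _; rewrite mul2n doubleS lamE /=; last first.
      by have := ltn_ord j; rewrite d1E; lia.
    by rewrite nodesS // nth_pm_nodes nth_behead nth_take // -ltn_predRL.
Qed.
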